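(* Let $m,n\ge1$ and $N=m+n$. There exists $\varepsilon>0$ such that every $\Psi\in C^1(\mathbb{G}(N,m))$ with $\|\Psi-1\|_{C^1(\mathbb{G}(N,m))}\le\varepsilon$ satisfies (AC1), i.e. $\dim\ker A(\mu)\le n$ for every Borel probability measure $\mu$ on $\mathbb{G}(N,m)$.
   Context: $\mathbb{G}(N,m)=\{P\in\mathbb{R}^{N\times N}: P=P^t,\ P^2=P,\ \mathrm{tr}(P)=m\}$ (a compact smooth submanifold of $\mathbb{R}^{N\times N}$); $T^\perp:=\mathrm{id}-T$. The area functional corresponds to $\Psi\equiv1$. For $\Psi\in C^1(\mathbb{G}(N,m))$, $D\Psi(T)$ denotes the differential (as a matrix, with respect to the Frobenius inner product) of any $C^1$ extension of $\Psi$ to a neighborhood of $\mathbb{G}(N,m)$ in $\mathbb{R}^{N\times N}$, $d\Psi(T):=D\Psi(T)+D\Psi(T)^t$, and $B_\Psi(T):=\Psi(T)T+T^\perp d\Psi(T)T$ (independent of the extension). For a Borel probability measure $\mu$ on $\mathbb{G}(N,m)$, $A(\mu):=\int_{\mathbb{G}(N,m)}B_\Psi(T)\,d\mu(T)\in\mathbb{R}^{N\times N}$. *)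

(* Defs.v *)
From HB Require Import structures.
From mathcomp Require Import all_boot all_order all_algebra.
From mathcomp Require Import all_classical all_reals all_analysis.

Set Implicit Arguments.
Unset Strict Implicit.
Unset Printing Implicit Defensive.

Import Order.TTheory GRing.Theory Num.Theory.
Import numFieldNormedType.Exports.

Local Open Scope classical_set_scope.
Local Open Scope ring_scope.

Definition grassmannian (R : realType) (N m : nat) : set 'M[R]_N :=
  [set P | [/\ P = P^T, P *m P = P & \tr P = m%:R]].

Lemma grassmannian_block (R : realType) (m n : nat) :
  grassmannian m (block_mx 1%:M 0 0 0 : 'M[R]_(m + n)).
Proof.
split; first by rewrite tr_block_mx !trmx0 trmx1.
- by rewrite mulmx_block !(mulmx0, mul0mx, mul1mx, addr0).
- by rewrite mxtrace_block mxtrace1 mxtrace0 addr0.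
Qed.

(* G(m + n, m) as a type, with the topology induced by the space of matrices.
   Measurable types are pointed, hence the base point. *)
Definition Gr (R : realType) (m n : nat) : Type :=
  set_type (grassmannian m : set 'M[R]_(m + n)).

HB.instance Definition _ (R : realType) (m n : nat) :=
  Topological.copy (Gr R m n)
    (set_type (grassmannian m : set 'M[R]_(m + n))).
HB.instance Definition _ (R : realType) (m n : nat) :=
  isPointed.Build (Gr R m n)
    (SigSub (mem_set (grassmannian_block R m n)) : Gr R m n).

Definition mx_of (R : realType) (m n : nat) (T : Gr R m n) : 'M[R]_(m + n) :=
  set_val T.

Definition borelGr (R : realType) (m n : nat) :=
  g_sigma_algebraType (@open (Gr R m n)).

Definition frobenius_norm (R : realType) (N : nat) (X : 'M[R]_N) : R :=
  Num.sqrt (\tr (X^T *m X)).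

(* DF(X), the matrix representing the differential of F at X for the
   Frobenius inner product. *)
Definition gradient (R : realType) (N : nat) (F : 'M[R]_N -> R) (X : 'M[R]_N) :
    'M[R]_N :=
  \matrix_(i, j) 'd F X (delta_mx i j).

Section C1_functions.
Variables (R : realType) (m n : nat).
Implicit Types (Psi : Gr R m n -> R) (F : 'M[R]_(m + n) -> R).

(* F is defined on all matrices, but only its restriction to the neighborhood U
   of the Grassmannian is constrained. *)
Definition C1_extension Psi F : Prop :=
  (exists U : set 'M[R]_(m + n),
    [/\ open U, grassmannian m `<=` U &
        forall X, U X ->
          differentiable F X /\ {for X, continuous (gradient F)}]) /\
  forall T : Gr R m n, F (mx_of T) = Psi T.

Definition C1 Psi : Prop := exists F, C1_extension Psi F.

(* Curves in the Grassmannian whose velocity at time 0, a tangent vector at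
   gamma 0, has norm at most 1; differentiability at 0 only suffices to reach
   exactly the tangent vectors. *)
Definition unit_curve (gamma : R -> Gr R m n) : Prop :=
  derivable (fun t => mx_of (gamma t)) 0 1 /\
  frobenius_norm ('D_1 (fun t => mx_of (gamma t)) 0) <= 1.

(* sup |Psi| + sup |d_T Psi|, where |d_T Psi| is the operator norm on the
   tangent space at T, and the differential of Psi in the direction gamma'(0)
   is (Psi o gamma)'(0). *)
Definition C1_norm Psi : \bar R :=
  (ereal_sup [set `|Psi T|%:E | T in [set: Gr R m n]] +
   ereal_sup [set `|'D_1 (Psi \o gamma) 0|%:E | gamma in unit_curve])%E.

Definition B_Psi Psi F (T : Gr R m n) : 'M[R]_(m + n) :=
  let P := mx_of T in
  let dPsi := gradient F P + (gradient F P)^T in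
  Psi T *: P + (1%:M - P) *m dPsi *m P.

Definition A_Psi Psi F (mu : probability (borelGr R m n) R) : 'M[R]_(m + n) :=
  \matrix_(i, j) \int[mu]_T (B_Psi Psi F T i j).

(* B_Psi and A_Psi do not depend on the C^1 extension F of Psi, so F is universally
   quantified.  kermx is the kernel of the action on row vectors, so the kernel
   of v |-> A v is that of the transpose. *)
Definition AC1 Psi : Prop :=
  forall F, C1_extension Psi F ->
  forall mu : probability (borelGr R m n) R,
    (\rank (kermx (A_Psi Psi F mu)^T) <= n)%N.

End C1_functions.

(* Main.v *)
Require Import Defs.
From mathcomp Require Import all_boot all_order all_algebra.
From mathcomp Require Import all_classical all_reals all_analysis.
From mathcomp Require Import measurable_realfun.
From mathcomp Require Import ring lra.

(* For Psi = 1, A(mu) is the mean of the projections T, and if Q is the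
   orthogonal projection onto a subspace of dimension at least n + 1, then
   tr(Q T) >= tr Q + tr T - (m + n) >= 1 for every T.  For Psi close to 1 in C^1,
   every entry of B_Psi(T) - T is at most 3 eps in absolute value: the entry
   (i, j) of T^perp dPsi(T) T is the derivative of Psi along the tangent vector
   a b^t + b a^t with a = T e_j and b = T^perp e_i.  Hence tr(Q B_Psi(T)) stays
   bounded below by a positive constant, and so does its mean tr(Q A(mu)), which
   would vanish if Q projected onto a subspace of ker A(mu). *)

Set Implicit Arguments.
Unset Strict Implicit.
Unset Printing Implicit Defensive.

Import Order.TTheory GRing.Theory Num.Theory.
Import numFieldNormedType.Exports.

Local Open Scope classical_set_scope.
Local Open Scope ring_scope.

(** * Orthogonal projections: traces of products and bounds on entries *)

Definition orthoproj (R : realFieldType) N (P : 'M[R]_N) := P^T = P /\ P *m P = P.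

Section Orthoproj.
Variable R : realFieldType.

Lemma mxtrace_mul_tr_ge0 m n (X : 'M[R]_(m, n)) : 0 <= \tr (X *m X^T).
Proof.
rewrite /mxtrace; apply: sumr_ge0 => i _; rewrite mxE; apply: sumr_ge0 => j _.
by rewrite mxE -expr2 sqr_ge0.
Qed.

Lemma mxtrace_mul_tr_eq0 m n (X : 'M[R]_(m, n)) : \tr (X *m X^T) = 0 -> X = 0.
Proof.
have E i : (X *m X^T) i i = \sum_j X i j ^+ 2.
  by rewrite mxE; apply: eq_bigr => j _; rewrite mxE expr2.
move=> /eqP; rewrite /mxtrace psumr_eq0 => [/allP X0|i _]; last first.
  by rewrite E sumr_ge0 // => j _; exact: sqr_ge0.
apply/matrixP => i j; rewrite mxE.
have := X0 i (mem_index_enum i); rewrite E psumr_eq0 => [/allP Xi|k _]; last first.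
  exact: sqr_ge0.
by have := Xi j (mem_index_enum j); rewrite sqrf_eq0 => /eqP.
Qed.

(** If [L] annihilates [K *m K^T], then [L *m K] has zero Frobenius norm, hence vanishes, and [K]
    can be cancelled because its rows are independent. *)
Lemma gram_unitmx k n (K : 'M[R]_(k, n)) : row_free K -> K *m K^T \in unitmx.
Proof.
move=> Kfree; rewrite -row_free_unit -kermx_eq0; set L := kermx _.
have L0 : L *m (K *m K^T) = 0 by apply: mulmx_ker.
have : (L *m K) *m (L *m K)^T = 0 by rewrite trmx_mul !mulmxA -(mulmxA L) L0 mul0mx.
move=> /(congr1 mxtrace); rewrite mxtrace0 => /mxtrace_mul_tr_eq0 LK.
by rewrite -(inj_eq (row_free_inj Kfree)) LK mul0mx.
Qed.

(** The witness is the classical formula K^T (K K^T)^-1 K, whose trace is found by cyclicity. The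
    factorization through [K^T] serves to deduce A Q = 0 from A K^T = 0. *)
Lemma orthoproj_row_space k n (K : 'M[R]_(k, n)) : row_free K ->
  exists2 Q : 'M[R]_n, orthoproj Q & \tr Q = k%:R /\ exists L, Q = K^T *m L.
Proof.
move=> Kfree; have U := gram_unitmx Kfree.
exists (K^T *m (invmx (K *m K^T) *m K)); first split.
- by rewrite !trmx_mul trmx_inv trmx_mul !trmxK mulmxA.
- by rewrite !mulmxA -(mulmxA _ K) mulmxKV.
split; last by exists (invmx (K *m K^T) *m K).
by rewrite mxtrace_mulC -mulmxA mulVmx // mxtrace1.
Qed.

Lemma orthoprojC n (P : 'M[R]_n) : orthoproj P -> orthoproj (1%:M - P).
Proof.
move=> [Pt PP]; split; first by rewrite linearB /= trmx1 Pt.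
by rewrite mulmxBl mul1mx mulmxBr mulmx1 PP subrr subr0.
Qed.

(** By cyclicity and idempotence, tr(P Q) is the squared Frobenius norm of P Q. *)
Lemma mxtrace_orthoproj_ge0 n (P Q : 'M[R]_n) : orthoproj P -> orthoproj Q ->
  0 <= \tr (P *m Q).
Proof.
move=> [Pt PP] [Qt QQ]; have := mxtrace_mul_tr_ge0 (P *m Q).
by rewrite trmx_mul Pt Qt mulmxA -(mulmxA P) QQ mxtrace_mulC mulmxA PP.
Qed.

(** Expand 0 <= tr((1 - P)(1 - Q)), a trace of complementary projections. *)
Lemma mxtrace_orthoproj_ge n (P Q : 'M[R]_n) : orthoproj P -> orthoproj Q ->
  \tr P + \tr Q - n%:R <= \tr (P *m Q).
Proof.
move=> P_ Q_; have := mxtrace_orthoproj_ge0 (orthoprojC P_) (orthoprojC Q_).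
rewrite mulmxBl mul1mx mulmxBr mulmx1 !raddfB /= mxtrace1; lra.
Qed.

Lemma orthoproj_col_sum n (P : 'M[R]_n) j : orthoproj P -> \sum_i P i j ^+ 2 = P j j.
Proof.
move=> [Pt PP]; rewrite -{2}PP mxE; apply: eq_bigr => i _.
by rewrite -{2}Pt mxE expr2.
Qed.

(** The diagonal entry 1 - P j j of the complementary projection is a sum of squares. *)
Lemma orthoproj_diag_le1 n (P : 'M[R]_n) j : orthoproj P -> P j j <= 1.
Proof.
move=> P_; have /(orthoproj_col_sum j) := orthoprojC P_.
rewrite !mxE eqxx mulr1n => H; rewrite -subr_ge0 -H.
by apply: sumr_ge0 => i _; exact: sqr_ge0.
Qed.

Lemma orthoproj_entry_le1 n (P : 'M[R]_n) i j : orthoproj P -> `|P i j| <= 1.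
Proof.
move=> P_; rewrite -(@expr_le1 _ 2) ?normr_ge0 //.
apply: le_trans (orthoproj_diag_le1 j P_).
rewrite -(orthoproj_col_sum j P_) (bigD1 i) //= real_normK ?num_real //.
by rewrite lerDl sumr_ge0 // => k _; exact: sqr_ge0.
Qed.

(** * Scalar products of columns and rank-one matrices *)

Definition dotc n (u v : 'cV[R]_n) : R := (u^T *m v) 0 0.

Lemma dotcE n (u : 'cV[R]_n) : dotc u u = \sum_i u i 0 ^+ 2.
Proof. by rewrite /dotc mxE; apply: eq_bigr => i _; rewrite mxE expr2. Qed.

Lemma dotc_ge0 n (u : 'cV[R]_n) : 0 <= dotc u u.
Proof. by rewrite dotcE sumr_ge0 // => i _; exact: sqr_ge0. Qed.

Lemma dotcC n (u v : 'cV[R]_n) : dotc u v = dotc v u.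
Proof. by rewrite /dotc !mxE; apply: eq_bigr => i _; rewrite !mxE mulrC. Qed.

Lemma dotcZ n k (u : 'cV[R]_n) : dotc (k *: u) (k *: u) = k ^+ 2 * dotc u u.
Proof. by rewrite !dotcE mulr_sumr; apply: eq_bigr => i _; rewrite mxE exprMn. Qed.

Lemma mul_outer n (u v w z : 'cV[R]_n) :
  u *m v^T *m (w *m z^T) = dotc v w *: (u *m z^T).
Proof.
rewrite mulmxA -(mulmxA u) (mx11_scalar (v^T *m w)) -/(dotc v w) mul_mx_scalar.
by rewrite -scalemxAl.
Qed.

Lemma mxtrace_outer n (u v : 'cV[R]_n) : \tr (u *m v^T) = dotc u v.
Proof. by rewrite mxtrace_mulC /mxtrace big_ord1 -/(dotc v u) dotcC. Qed.

End Orthoproj.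

(** * Rotating a projection in a plane, and the velocity of this curve *)

Section Rotation.
Variables (R : realFieldType) (n : nat) (P : 'M[R]_n) (a b : 'cV[R]_n).
Hypotheses (P_proj : orthoproj P) (Pa : P *m a = a) (Pb : P *m b = 0).

Let S := a *m b^T + b *m a^T.
Let al := dotc a a.
Let be := dotc b b.

(* The rotation in the plane of a and b that moves a towards b, with the time
   parametrized rationally so that no normalization of a is needed: it replaces
   the line of a by that of a + (t |a|^2) b. *)
Definition rot_proj (t : R) : 'M[R]_n :=
  P + (1 + t ^+ 2 * (al * be))^-1 *:
      (t *: S + t ^+ 2 *: (al *: (b *m b^T) - be *: (a *m a^T))).

Lemma dotc_range_ker : dotc a b = 0.
Proof. by rewrite /dotc -Pa trmx_mul (proj1 P_proj) -mulmxA Pb mulmx0 mxE. Qed.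

Lemma mxtrace_rot_proj t : \tr (rot_proj t) = \tr P.
Proof.
rewrite /rot_proj /S !(mxtraceD, mxtraceZ) raddfN /= !mxtraceZ !mxtrace_outer.
rewrite -/al -/be (dotcC b) dotc_range_ker; ring.
Qed.

(** Write the curve as P + D / c and put E = t^2 (al b b^t + be a a^t). Then P D + D P = D - E and
    D^2 = c E, so the E terms cancel in the square. *)
Lemma rot_proj_orthoproj t : orthoproj (rot_proj t).
Proof.
have [Pt PP] := P_proj.
have c0 : 1 + t ^+ 2 * (al * be) != 0.
  rewrite gt_eqF // ltr_wpDr //.
  exact: mulr_ge0 (sqr_ge0 _) (mulr_ge0 (dotc_ge0 a) (dotc_ge0 b)).
rewrite /rot_proj; set c := 1 + _ in c0 *; set D := (X in _ *: X).
have ba : dotc b a = 0 by rewrite dotcC dotc_range_ker.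
have aP : a^T *m P = a^T by rewrite -{1}Pt -trmx_mul Pa.
have bP : b^T *m P = 0 by rewrite -{1}Pt -trmx_mul Pb trmx0.
split.
  have trmxD (X Y : 'M[R]_n) : (X + Y)^T = X^T + Y^T by exact: raddfD.
  have trmxN (X : 'M[R]_n) : (- X)^T = - X^T by exact: raddfN.
  have trmxZ k (X : 'M[R]_n) : (k *: X)^T = k *: X^T by exact: linearZ.
  by rewrite /D /S !(trmxD, trmxN, trmxZ) !trmx_mul !trmxK Pt (addrC (b *m _)).
have distr_mulmx :=
  (@mulmxDr R, @mulmxDl R, @mulmxN R, @mulNmx R, =^~ @scalemxAr R, =^~ @scalemxAl R).
have PD : P *m D + D *m P = D - t ^+ 2 *: (al *: (b *m b^T) + be *: (a *m a^T)).
  rewrite /D /S !distr_mulmx !mulmxA Pa Pb -!(mulmxA _ _ P) aP bP !mulmx0 !mul0mx.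
  by apply/matrixP => i j; rewrite !mxE; ring.
have DD : D *m D = c *: (t ^+ 2 *: (al *: (b *m b^T) + be *: (a *m a^T))).
  rewrite /D /S !distr_mulmx !mul_outer -/al -/be ba dotc_range_ker /c.
  by apply/matrixP => i j; rewrite !mxE; ring.
rewrite mulmxDl !mulmxDr PP -!scalemxAr -!scalemxAl DD [c^-1 *: (c *: _)]scalerA.
rewrite mulVf // scale1r -addrA; congr (_ + _).
by rewrite addrA -!scalerDr PD subrK.
Qed.

End Rotation.

Lemma is_derive_rot_proj (R : realType) N (P : 'M[R]_N) (a b : 'cV[R]_N) :
  is_derive (0 : R) 1 (rot_proj P a b) (a *m b^T + b *m a^T).
Proof.
set S := a *m b^T + b *m a^T.
pose c (t : R) := (1 + t ^+ 2 * (dotc a a * dotc b b))^-1.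
pose E := dotc a a *: (b *m b^T) - dotc b b *: (a *m a^T).
have fE t : rot_proj P a b t = P + c t *: (t *: S + t ^+ 2 *: E) by [].
have f0 : rot_proj P a b 0 = P.
  by rewrite fE scale0r expr2 mul0r scale0r addr0 scaler0 addr0.
(* For h != 0 this expression is the difference quotient of the curve at 0; its factor [c h] tends
   to 1. *)
have cS : c h *: (S + h *: E) @[h --> (0 : R)] --> S.
  rewrite (_ : nbhs S = nbhs ((1 : R) *: (S + (0 : R) *: E))); last first.
    by rewrite scale0r addr0 scale1r.
  apply: cvgZ.
    rewrite -[X in _ --> X]invr1; apply: cvgV; first exact: oner_neq0.
    rewrite -[X in _ --> X]addr0; apply: cvgD; first exact: cvg_cst.
    rewrite -[X in _ --> X](mul0r (dotc a a * dotc b b)).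
    apply: cvgM; last exact: cvg_cst.
    rewrite -[X in _ --> X](mul0r 0); rewrite (_ : (fun _ => _) = (fun t => t * t)).
      by apply: cvgM; exact: cvg_id.
    by apply/funext => t; rewrite expr2.
  apply: cvgD; first exact: cvg_cst.
  by apply: cvgZ; [exact: cvg_id|exact: cvg_cst].
have D : h^-1 *: ((rot_proj P a b \o shift 0) (h *: 1) - rot_proj P a b 0)
    @[h --> (0 : R)^'] --> S.
  apply: cvg_trans (cvg_within_filter (fun h => h != 0) cS); apply: near_eq_cvg.
  near=> h; have h0 : h != 0 by near: h; exact: nbhs_dnbhs_neq.
  rewrite /= f0 addr0 [h *: 1]mulr1 fE [P + _]addrC addrK.
  rewrite [RHS]scalerA mulrC -scalerA; congr (_ *: _).
  by rewrite [RHS]scalerDr !(scalerA h^-1) mulVf // scale1r expr2 mulrA mulVf // mul1r.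
split; last exact: cvg_lim D.
by apply/cvg_ex; exists S.
Unshelve. all: by end_near. Qed.

(** * Derivatives along curves, integrals of finite sums, continuity of entries *)

Lemma derive_comp_curve (R : realType) (V : normedModType R)
    (F : V -> R) (g : R -> V) (v : V) :
  differentiable F (g 0) -> is_derive (0 : R) 1 g v ->
  derivable (F \o g) 0 1 /\ 'D_1 (F \o g) 0 = 'd F (g 0) v.
Proof.
move=> dF [dg gv]; have dg' : differentiable g 0 by apply/derivable1_diffP.
split; first by apply/derivable1_diffP; exact: differentiable_comp.
rewrite deriveE; last exact: differentiable_comp.
by rewrite diff_comp //= -gv deriveE.
Qed.

Lemma diff_gradient (R : realType) N (F : 'M[R]_N -> R) (X V : 'M[R]_N) :
  'd F X V = \tr ((gradient F X)^T *m V).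
Proof.
rewrite {1}(matrix_sum_delta V) linear_sum /= /mxtrace.
rewrite [RHS](eq_bigr (fun j => \sum_i V i j * gradient F X i j)).
  rewrite [RHS]exchange_big; apply: eq_bigr => i _.
  rewrite linear_sum; apply: eq_bigr => j _.
  by rewrite linearZ /= mxE.
by move=> j _; rewrite mxE; apply: eq_bigr => i _; rewrite mxE mulrC.
Qed.

(** Integrability is proved together with the equality, since additivity of the integral needs it at
    each step of the induction. *)
Lemma Rintegral_sum (R : realType) d (S : measurableType d)
    (mu : {measure set S -> \bar R}) (I : Type) (s : seq I) (f : I -> S -> R) :
  (forall i, mu.-integrable setT (EFin \o f i)) ->
  mu.-integrable setT (EFin \o (fun x => \sum_(i <- s) f i x)) /\
  \int[mu]_x (\sum_(i <- s) f i x) = \sum_(i <- s) \int[mu]_x f i x.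
Proof.
move=> fi; elim: s => [|i s [IH1 IH2]].
  have -> : (fun x => \sum_(i <- [::]) f i x) = cst 0.
    by apply/funext => x; rewrite big_nil.
  by split; [exact: integrable0|rewrite big_nil Rintegral_cst // mul0r].
have E : (fun x => \sum_(j <- i :: s) f j x) = (fun x => f i x + \sum_(j <- s) f j x).
  by apply/funext => x; rewrite big_cons.
rewrite E big_cons RintegralD // IH2; split=> //.
exact: (integrableD measurableT (fi i) IH1).
Qed.

(** The matrix has the shape of [B_Psi], with [c], [P], [G] in the roles of Psi, the projection and
    the gradient; its entries are polynomials in theirs. *)
Lemma continuous_first_variation_entry (R : realType) (X : topologicalType) N
    (c : X -> R) (P G : X -> 'M[R]_N) :
  continuous c -> (forall k l, continuous (fun x => P x k l)) ->
  (forall k l, continuous (fun x => G x k l)) ->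
  forall i j, continuous (fun x =>
    (c x *: P x + (1%:M - P x) *m (G x + (G x)^T) *m P x) i j).
Proof.
move=> cc cP cG i j.
rewrite (_ : (fun x => _) = (fun x => c x * P x i j +
  \sum_k (\sum_l ((i == l)%:R - P x i l) * (G x l k + G x k l)) * P x k j)); last first.
  apply/funext => x; rewrite !mxE; congr (_ + _); apply: eq_bigr => k _.
  by rewrite mxE; congr (_ * _); apply: eq_bigr => l _; rewrite !mxE.
move=> x; apply: cvgD; first by apply: cvgM; [exact: cc|exact: cP].
apply: cvg_big => [|k _]; first exact: add_continuous.
 apply: cvgM; last exact: cP.
apply: cvg_big => [|l _]; first exact: add_continuous.
 apply: cvgM; last by apply: cvgD; exact: cG.
by apply: cvgB; [exact: cvg_cst|exact: cP].
Qed.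

(** * The Grassmannian: topology, measurability and the C^1 norm *)

Section Grassmannian.
Variables (R : realType) (m n : nat).
Implicit Types (Psi : Gr R m n -> R) (F : 'M[R]_(m + n) -> R) (T : Gr R m n).

Lemma grassmannian_mx_of T : grassmannian m (mx_of T).
Proof. exact: set_valP. Qed.

Lemma mx_of_orthoproj T : orthoproj (mx_of T).
Proof. by have [/esym tr_P PP _] := grassmannian_mx_of T. Qed.

Lemma mxtrace_mx_of T : \tr (mx_of T) = m%:R.
Proof. by have [] := grassmannian_mx_of T. Qed.

Lemma mx_of_continuous : continuous (@mx_of R m n).
Proof. exact: initial_continuous. Qed.

(** A sigma type rather than an existential, so that a curve of projections yields a function into
    [Gr]. *)
Lemma orthoproj_Gr (P : 'M[R]_(m + n)) :
  orthoproj P -> \tr P = m%:R -> {T : Gr R m n | mx_of T = P}.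
Proof.
move=> [Pt PP] trP; have GP : grassmannian m P by split.
by exists (SigSub (mem_set GP)).
Qed.

(** Open intervals generate the Borel sets of the line, and their preimages are open, hence among
    the generators of [borelGr]. *)
Lemma continuous_Gr_measurable (f : Gr R m n -> R) :
  continuous f -> measurable_fun setT (f : borelGr R m n -> R).
Proof.
move=> /continuousP cf; apply: (measurability _ (RGenOpens.measurableE R)).
move=> _ [_ [a [b ->]] <-]; rewrite setTI.
apply: sub_sigma_algebra; apply: cf; exact: interval_open.
Qed.

Lemma C1_norm_bound Psi (e : R) : (C1_norm Psi <= e%:E)%E ->
  (forall T, `|Psi T| <= e) /\
  (forall gamma, unit_curve gamma -> `|'D_1 (Psi \o gamma) 0| <= e).
Proof.
rewrite /C1_norm; set A := (X in (ereal_sup X + _)%E).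
set B := (X in (_ + ereal_sup X)%E) => AB.
have A0 : (0 <= ereal_sup A)%E.
  apply: (@le_trans _ _ `|Psi point|%:E); first by rewrite lee_fin.
  by apply: ereal_sup_ubound; exists point.
have B0 : (0 <= ereal_sup B)%E.
  (* A constant curve has velocity 0, so the second supremum is over a nonempty set of nonnegative
     numbers. Both suprema being nonnegative, each is at most their sum. *)
  pose g (_ : R) : Gr R m n := point.
  apply: (@le_trans _ _ `|'D_1 (Psi \o g) 0|%:E); first by rewrite lee_fin.
  apply: ereal_sup_ubound; exists g => //; split; first exact: derivable_cst.
  by rewrite derive_cst /frobenius_norm mulmx0 mxtrace0 sqrtr0.
split=> [T|g ug]; rewrite -lee_fin.
  by apply: le_trans (le_trans (leeDl _ B0) AB); apply: ereal_sup_ubound; exists T.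
by apply: le_trans (le_trans (leeDr _ A0) AB); apply: ereal_sup_ubound; exists g.
Qed.

(** * Closeness of [B_Psi] to the projection, entry by entry *)

Section Entries.
Variables (Psi : Gr R m n -> R) (F : 'M[R]_(m + n) -> R) (e : R).
Hypotheses (PsiF : C1_extension Psi F)
  (Psi1 : (C1_norm (fun T => Psi T - 1)%R <= e%:E)%E).

Lemma C1_extension_differentiable T : differentiable F (mx_of T).
Proof.
by have [[U [_ GU dF]] _] := PsiF; have [] := dF _ (GU _ (grassmannian_mx_of T)).
Qed.

Lemma gradient_continuous T : {for mx_of T, continuous (gradient F)}.
Proof.
by have [[U [_ GU dF]] _] := PsiF; have [] := dF _ (GU _ (grassmannian_mx_of T)).
Qed.

(** The squared Frobenius norm of a b^t + b a^t is 2 |a|^2 |b|^2 as a and b are orthogonal. The last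
    hypothesis thus makes the rotation curve through [T] a [unit_curve], along which the C^1 norm
    controls the derivative. *)
Lemma tangent_diff_le T (a b : 'cV[R]_(m + n)) :
  mx_of T *m a = a -> mx_of T *m b = 0 -> 2 * (dotc a a * dotc b b) <= 1 ->
  `|'d F (mx_of T) (a *m b^T + b *m a^T)| <= e.
Proof.
move=> Pa Pb ab1; have P_proj := mx_of_orthoproj T.
pose c t := orthoproj_Gr (rot_proj_orthoproj P_proj Pa Pb t)
  (etrans (mxtrace_rot_proj P_proj Pa Pb t) (mxtrace_mx_of T)).
pose g t := sval (c t).
have gE : (fun t => mx_of (g t)) = rot_proj (mx_of T) a b.
  by apply/funext => t; exact: (svalP (c t)).
have g0 : mx_of (g 0) = mx_of T.
  by rewrite (svalP (c 0)) /rot_proj scale0r expr2 mul0r scale0r addr0 scaler0 addr0.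
have dg : is_derive (0 : R) 1 (fun t => mx_of (g t)) (a *m b^T + b *m a^T).
  by rewrite gE; exact: is_derive_rot_proj.
have ug : unit_curve g.
  case: dg => dg Dg; split=> //; rewrite Dg /frobenius_norm -[leRHS]sqrtr1.
  apply: ler_wsqrtr; apply: le_trans ab1.
  have ba : dotc b a = 0 by rewrite dotcC (dotc_range_ker P_proj Pa Pb).
  rewrite [(_ + _)^T]linearD /= !trmx_mul !trmxK mulmxDl !mulmxDr !mul_outer ba.
  rewrite (dotc_range_ker P_proj Pa Pb) !(mxtraceD, mxtraceZ) !mxtrace_outer; lra.
have dF : differentiable F (mx_of (g 0)) by exact: C1_extension_differentiable.
have [dFg DFg] := derive_comp_curve dF dg.
have [_ /(_ g ug)] := C1_norm_bound Psi1.
suff -> : (fun T => Psi T - 1) \o g = (F \o (fun t => mx_of (g t))) - cst 1.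
  rewrite deriveB; [|exact: dFg|exact: derivable_cst].
  by rewrite derive_cst subr0 DFg g0.
by apply/funext => t /=; rewrite -(proj2 PsiF).
Qed.

(** Halving a brings 2 |a|^2 |b|^2 down to at most 1/2; linearity of the differential then costs a
    factor 2. *)
Lemma tangent_diff_le2 T (a b : 'cV[R]_(m + n)) :
  mx_of T *m a = a -> mx_of T *m b = 0 -> dotc a a <= 1 -> dotc b b <= 1 ->
  `|'d F (mx_of T) (a *m b^T + b *m a^T)| <= 2 * e.
Proof.
move=> Pa Pb a1 b1.
have : `|'d F (mx_of T) ((2^-1 *: a) *m b^T + b *m (2^-1 *: a)^T)| <= e.
  apply: tangent_diff_le => //; first by rewrite -scalemxAr Pa.
  rewrite dotcZ.
  have := ler_pM (dotc_ge0 a) (dotc_ge0 b) a1 b1; lra.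
rewrite [(_ *: a)^T]linearZ /= -scalemxAl -scalemxAr -scalerDr linearZ /= normrM.
by rewrite ger0_norm //; lra.
Qed.

(** The factor 3 is 1 + 2: one [e] from (Psi - 1) P, and 2 [e] from the differential along a tangent
    vector built from columns of P and 1 - P, of norm at most 1. *)
Lemma B_Psi_entry T i j : `|B_Psi Psi F T i j - mx_of T i j| <= 3 * e.
Proof.
have P_proj := mx_of_orthoproj T; have [Pt PP] := P_proj.
have Q_proj := orthoprojC P_proj; have [Qt QQ] := Q_proj.
rewrite /B_Psi; set P := mx_of T in P_proj Pt PP Q_proj Qt QQ *.
set G := gradient F P.
have [/(_ T) PsiT _] := C1_norm_bound Psi1.
have dotcol (X : 'M[R]_(m + n)) k : orthoproj X -> dotc (col k X) (col k X) <= 1.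
  move=> X_; rewrite dotcE (eq_bigr (fun l => X l k ^+ 2)) => [|l _]; last by rewrite mxE.
  by rewrite orthoproj_col_sum // orthoproj_diag_le1.
pose a := col j P; pose b := col i (1%:M - P).
have : `|'d F P (a *m b^T + b *m a^T)| <= 2 * e.
  apply: tangent_diff_le2; rewrite -/P ?dotcol // /a /b ?colE ?mulmxA ?PP //.
  by rewrite mulmxBr mulmx1 PP subrr mul0mx.
suff -> : 'd F P (a *m b^T + b *m a^T) = ((1%:M - P) *m (G + G^T) *m P) i j.
  move=> H; set Y := (_ *m _ *m P) in H *.
  have -> : (Psi T *: P + Y) i j - P i j = (Psi T - 1) * P i j + Y i j.
    by rewrite !mxE; ring.
  apply: le_trans (ler_normD _ _) _; rewrite normrM.
  have := ler_pM (normr_ge0 _) (normr_ge0 _) PsiT (orthoproj_entry_le1 i j P_proj); lra.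
(* Both sides equal b^t (G + G^t) a; by symmetry of 1 - P, its row [i] is b^t. *)
rewrite diff_gradient -/G mulmxDr mxtraceD.
have -> : ((1%:M - P) *m (G + G^T) *m P) i j = (b^T *m (G + G^T) *m a) 0 0.
  by rewrite /a /b tr_col Qt colE mulmxA -colE -!row_mul !mxE.
rewrite mulmxDr mulmxDl mxE !mulmxA !mxtrace_outer addrC.
by rewrite (dotcC _ b) /dotc trmx_mul trmxK !mulmxA.
Qed.

(** The main part tr(Q T) is at least (n + 1) + m - (m + n) = 1. The error is a sum of (m + n)^2
    products of an entry of Q, at most 1 in absolute value, and one of B - T, at most 3 [e]. *)
Lemma mxtrace_mul_B_Psi_ge (Q : 'M[R]_(m + n)) T : orthoproj Q -> n.+1%:R <= \tr Q ->
  1 - 3 * e * ((m + n) ^ 2)%:R <= \tr (Q *m B_Psi Psi F T).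
Proof.
move=> Q_ trQ; set B := B_Psi Psi F T.
rewrite -[B](subrKC (mx_of T)) mulmxDr mxtraceD.
have := mxtrace_orthoproj_ge Q_ (mx_of_orthoproj T).
rewrite mxtrace_mx_of natrD.
suff : `|\tr (Q *m (B - mx_of T))| <= 3 * e * ((m + n) ^ 2)%:R.
  by rewrite ler_norml => /andP[H _]; move: trQ; rewrite -addn1 natrD; lra.
rewrite /mxtrace; apply: le_trans (ler_norm_sum _ _ _) _.
have le_entry i : `|(Q *m (B - mx_of T)) i i| <= 3 * e * (m + n)%:R.
  rewrite mxE; apply: le_trans (ler_norm_sum _ _ _) _.
  have le3e j : `|Q i j * (B - mx_of T) j i| <= 3 * e.
    rewrite normrM -[leRHS]mul1r; apply: ler_pM; rewrite ?orthoproj_entry_le1 //.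
    by rewrite mxE [(- mx_of T) j i]mxE; exact: B_Psi_entry.
  apply: le_trans (ler_sum _ (fun j _ => le3e j)) _.
  by rewrite sumr_const card_ord mulr_natr.
apply: le_trans (ler_sum _ (fun i _ => le_entry i)) _.
rewrite sumr_const card_ord -[leLHS]mulr_natr.
by rewrite -[leLHS]mulrA -natrM mulnn.
Qed.

Lemma B_Psi_continuous i j : continuous (fun T => B_Psi Psi F T i j).
Proof.
have cmx k l : continuous (fun T : Gr R m n => mx_of T k l).
  move=> T; apply: (continuous_comp (f := @mx_of R m n)
    (g := fun X : 'M[R]_(m + n) => X k l)).
    exact: mx_of_continuous.
  exact: coord_continuous.
have cG k l : continuous (fun T : Gr R m n => gradient F (mx_of T) k l).
  move=> T; apply: (continuous_comp (f := gradient F \o @mx_of R m n)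
    (g := fun X : 'M[R]_(m + n) => X k l)).
    by apply: continuous_comp; [exact: mx_of_continuous|exact: gradient_continuous].
  exact: coord_continuous.
have cPsi : continuous Psi.
  have -> : Psi = F \o @mx_of R m n by apply/funext => T /=; rewrite (proj2 PsiF).
  move=> T; apply: continuous_comp; first exact: mx_of_continuous.
  exact/differentiable_continuous/C1_extension_differentiable.
exact: (continuous_first_variation_entry cPsi cmx cG).
Qed.

Lemma B_Psi_integrable (mu : probability (borelGr R m n) R) i j :
  mu.-integrable setT (EFin \o (fun T : borelGr R m n => B_Psi Psi F T i j)).
Proof.
apply: measurable_bounded_integrable => //.
- by apply: (le_lt_trans (probability_le1 mu measurableT)); rewrite ltry.
- apply: continuous_Gr_measurable; exact: B_Psi_continuous.
(* An entry of the projection is at most 1 in absolute value, and [B_Psi] differs from it by at most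
   3 [e]. *)
exists (3 * e + 1); split; first exact: num_real.
move=> x xe T _ /=; apply: le_trans (ltW xe).
have := B_Psi_entry T i j; have := orthoproj_entry_le1 i j (mx_of_orthoproj T).
rewrite !ler_norml; lra.
Qed.

End Entries.

End Grassmannian.

(** * Averaging the trace bound against a projection onto the kernel *)

Theorem theorem3 (R : realType) (m n : nat) (hm : (1 <= m)%N) (hn : (1 <= n)%N) :
  exists2 eps : R, 0 < eps &
    forall Psi : Gr R m n -> R,
      C1 Psi -> (C1_norm (fun T => Psi T - 1)%R <= eps%:E)%E -> AC1 Psi.
Proof.
have N0 : 0 < ((m + n) ^ 2)%:R :> R by rewrite ltr0n expn_gt0 addn_gt0 hm.
(* This choice gives 3 eps (m + n)^2 = 1/2, leaving the positive lower bound 1/2 for the trace. *)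
exists (6 * ((m + n) ^ 2)%:R)^-1; first by rewrite invr_gt0 mulr_gt0.
set e := _^-1 => Psi _ Psi1 F PsiF mu; rewrite leqNgt; apply/negP => lt_n_ker.
set A := A_Psi Psi F mu in lt_n_ker.
have [Q Q_proj [trQ [L QE]]] := orthoproj_row_space (row_base_free (kermx A^T)).
(* A basis K of the kernel satisfies K A^t = 0, that is A K^t = 0, and Q factors through K^t on the
   left. *)
have AQ : A *m Q = 0.
  have : row_base (kermx A^T) *m A^T = 0 by apply/sub_kermxP; rewrite eq_row_base.
  by move=> /(congr1 trmx); rewrite trmx_mul trmxK QE mulmxA trmx0 => ->; rewrite mul0mx.
have {}trQ : n.+1%:R <= \tr Q by rewrite trQ ler_nat.
have Bi := B_Psi_integrable PsiF Psi1 mu.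
have trB T : \tr (Q *m B_Psi Psi F T) = \sum_i \sum_j Q i j * B_Psi Psi F T j i.
  by rewrite /mxtrace; apply: eq_bigr => i _; rewrite mxE.
have QBi i j : mu.-integrable setT (EFin \o (fun T => Q i j * B_Psi Psi F T j i)).
  exact: (integrableZl measurableT (Q i j) (Bi j i)).
have row_int i := Rintegral_sum (index_enum _) (QBi i).
have [trBi trBE] := Rintegral_sum (index_enum _) (fun i => proj1 (row_int i)).
have : 1 - 3 * e * ((m + n) ^ 2)%:R <=
    \int[mu]_T (\sum_i \sum_j Q i j * B_Psi Psi F T j i).
  (* The constant is its own mean because [mu] has total mass 1, so the pointwise bound
     integrates. *)
  rewrite -[leLHS]mulr1 -[X in _ * X](_ : fine (mu setT) = 1); last first.
    by rewrite probability_setT.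
  rewrite -Rintegral_cst //; apply: le_Rintegral => //.
    by apply: finite_measure_integrable_cst.
  by move=> T _; rewrite -trB; exact: (mxtrace_mul_B_Psi_ge PsiF Psi1).
have -> : \int[mu]_T (\sum_i \sum_j Q i j * B_Psi Psi F T j i) = \tr (Q *m A).
  rewrite trBE /mxtrace; apply: eq_bigr => i _; rewrite mxE (proj2 (row_int i)).
  by apply: eq_bigr => j _; rewrite mxE RintegralZl.
(* The mean tr(Q A) = tr(A Q) is 0, whereas the bound makes it at least 1/2. *)
rewrite mxtrace_mulC AQ mxtrace0.
have -> : e = 6^-1 / ((m + n) ^ 2)%:R by rewrite /e invfM.
by rewrite mulrA mulfVK ?gt_eqF //; lra.
Qed.
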